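(* Let $p>2$ be a prime, $\lambda$ an ordering of $\mathbb{F}_p\times\mathbb{F}_p$, and $G_\lambda=\langle A,B_\lambda\rangle$ the corresponding Sushchansky group. The action of $G_\lambda$ on the tree $T$ (defined in the context, and identified with the tree of words over $X$ via $xyw\mapsto xw$) is faithful and level-transitive, and the generators act on $T$ as the automorphisms $$A=\sigma,\qquad B_\lambda=(q_1,r_1,\sigma,1,\dots,1),$$ where $q_i=(q_{i+1},\sigma^{u_i},1,\dots,1)$ and $r_i=(r_{i+1},\sigma^{v_i},1,\dots,1)$, with indices modulo $p^2$.
   Context: Tree automorphisms. Let $p>2$ be a prime and $X=\{0,1,\dots,p-1\}$, identified with the field $\mathbb{F}_p$. The set $X^*$ of finite words over $X$ is a rooted $p$-ary tree (root the empty word; $w$ is joined to $wx$). For $g\in\mathrm{Aut}\,X^*$ and $v\in X^*$, the restriction $g|_v\in \mathrm{Aut}\,X^*$ is defined by $g(vw)=g(v)\,g|_v(w)$. Write $g=(g|_0,g|_1,\dots,g|_{p-1})\pi_g$, where $\pi_g$ is the permutation of $X$ induced by $g$ (omitted if trivial). In a product $gh$, $g$ acts first. Let $\sigma=(0,1,\dots,p-1)$ be the cyclic permutation $x\mapsto x+1$ of $X$; $\sigma$ also denotes the automorphism $(1,\dots,1)\sigma$. Sushchansky groups (original action). Let $\lambda=\{(\alpha_i,\beta_i): i=1,\dots,p^2\}$ be an ordering (enumeration without repetition) of all pairs in $\mathbb{F}_p\times\mathbb{F}_p$. Put $u_i=0$, $v_i=1$ if $\beta_i=0$, and $u_i=1$,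 $v_i=-\alpha_i/\beta_i$ if $\beta_i\neq 0$. Define automorphisms $q_i,r_i$ ($i=1,\dots,p^2$, indices taken modulo $p^2$) of $X^*$ recursively by $$q_i=(q_{i+1},\sigma^{u_i},1,\dots,1),\qquad r_i=(r_{i+1},\sigma^{v_i},1,\dots,1).$$ In the original action on $X^*$, $A=(1,\sigma,\sigma^2,\dots,\sigma^{p-1})\sigma$, and $B_\lambda$ is the automorphism acting trivially on $X^2$ with $B_\lambda|_{00}=q_1$, $B_\lambda|_{10}=r_1$, $B_\lambda|_{21}=\sigma$, and all other restrictions $B_\lambda|_{xy}$, $xy\in X^2$, trivial. The Sushchansky group of type $\lambda$ is $G_\lambda=\langle A,B_\lambda\rangle\le \mathrm{Aut}\,X^*$. The tree $T$. Let $\mathrm{Orb}(00)$ be the orbit of the word $00$ under $G_\lambda$; it contains, for each $x\in X$, exactly one word of the form $xy$. Let $V=\{xyw\in X^*: xy\in\mathrm{Orb}(00),\ w\in X^*\}\cup\{\emptyset\}$, a $G_\lambda$-invariant set. $T$ is the rooted $p$-ary tree with vertex set $V$ and root $\emptyset$, in which $\emptyset$ is joined to every vertex of $\mathrm{Orb}(00)$ and $w$ is joined to $wx$ for nonempty $w\in V$, $x\in X$. The group $G_\lambda$ acts on $T$ by automorphisms. The bijection $xyw\mapsto xw$ ($xy\in\mathrm{Orb}(00)$, $w\in X^*$), $\emptyset\mapsto\emptyset$, identifies $T$ with the tree of words over $X$. *)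

(* Defs.v *)
From HB Require Import structures.
From mathcomp Require Import all_boot all_order all_algebra all_fingroup.
From mathcomp Require Import boolp.

Set Implicit Arguments.
Unset Strict Implicit.
Unset Printing Implicit Defensive.

Local Open Scope group_scope.

Section Generated.
Variable gT : groupType.

(* The subgroup <S>: the intersection of all subgroups of gT containing S. *)
Definition generated (S : gT -> Prop) : {pred gT} := fun g =>
  `[< forall H : {pred gT}, group_closed H ->
        (forall s, S s -> s \in H) -> g \in H >].

Variable S : gT -> Prop.

Lemma generatedP g :
  reflect (forall H : {pred gT}, group_closed H ->
             (forall s, S s -> s \in H) -> g \in H)
          (g \in generated S).
Proof. exact: asboolP. Qed.

Lemma mem_generated s : S s -> s \in generated S.
Proof. by move=> Ss; apply/generatedP => H _; apply. Qed.

Lemma generated_group : group_closed (generated S).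
Proof.
split=> [|g h /generatedP Gg /generatedP Gh]; apply/generatedP => H gH SH.
  by case: gH.
by case: (gH) => _; apply; [apply: Gg | apply: Gh].
Qed.

HB.instance Definition _ :=
  isMulClosed.Build gT (generated S) (group_closedM generated_group).
HB.instance Definition _ :=
  isMul1Closed.Build gT (generated S) generated_group.1.
HB.instance Definition _ :=
  isInvClosed.Build gT (generated S) (group_closedV generated_group).

Record gen_group : Type :=
  GenGroup { gen_val : gT; gen_valP : gen_val \in generated S }.

HB.instance Definition _ := [isSub of gen_group for gen_val].
HB.instance Definition _ := [Choice of gen_group by <:].
HB.instance Definition _ := 
  SubChoice_isSubGroup.Build gT (generated S) gen_group generated_group.

Definition gen_of s (Ss : S s) : gen_group := GenGroup (mem_generated Ss).

End Generated.

(* Edges are oriented away from the root: [child u v] means that u and v are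
   joined and that u is the one closer to the root. *)
Record rtree := RTree {
  vertex :> Type;
  root : vertex;
  child : vertex -> vertex -> Prop
}.

Fixpoint level (t : rtree) (n : nat) (v : t) : Prop :=
  if n is m.+1 then exists2 u : t, level m u & child u v else v = root t.

Record rtree_iso (s t : rtree) := RTreeIso {
  iso_fun :> s -> t;
  iso_inv : t -> s;
  iso_funK : cancel iso_fun iso_inv;
  iso_invK : cancel iso_inv iso_fun;
  iso_root : iso_fun (root s) = root t;
  iso_child : forall u v, child u v -> child (iso_fun u) (iso_fun v);
  iso_inv_child : forall u v, child u v -> child (iso_inv u) (iso_inv v)
}.

Lemma iso_ext (s t : rtree) (f g : rtree_iso s t) : f =1 g -> f = g.
Proof.
case: f g => [f f' fK f'K f0 fc fc'] [g g' gK g'K g0 gc gc'] /= fg.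
have {}fg : f = g by apply: funext.
subst g.
have fg' : f' = g' by apply: funext => x; rewrite -[in LHS](g'K x) fK.
by subst g'; congr RTreeIso; apply: Prop_irrelevance.
Qed.

Definition iso_sym (s t : rtree) (f : rtree_iso s t) : rtree_iso t s.
Proof.
apply: (@RTreeIso t s (iso_inv f) f (iso_invK f) (iso_funK f)).
- by rewrite -(iso_root f) iso_funK.
- exact: iso_inv_child.
- exact: iso_child.
Defined.

Definition iso_id (t : rtree) : rtree_iso t t :=
  @RTreeIso t t id id (fun=> erefl) (fun=> erefl) erefl
    (fun _ _ uv => uv) (fun _ _ uv => uv).

(* f first, then g *)
Definition iso_comp (s t r : rtree) (f : rtree_iso s t) (g : rtree_iso t r) :
  rtree_iso s r.
Proof.
apply: (@RTreeIso s r (fun v => g (f v)) (fun v => iso_inv f (iso_inv g v))).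
- by move=> v; rewrite !iso_funK.
- by move=> v; rewrite !iso_invK.
- by rewrite !iso_root.
- by move=> u v uv; do 2!apply: iso_child.
- by move=> u v uv; do 2!apply: iso_inv_child.
Defined.

Definition aut (t : rtree) : Type := rtree_iso t t.

HB.instance Definition _ (t : rtree) := gen_eqMixin (aut t).
HB.instance Definition _ (t : rtree) := gen_choiceMixin (aut t).

Section AutGroup.
Variable t : rtree.
Implicit Types f g h : aut t.

Let autA : associative (fun f g => iso_comp f g : aut t).
Proof. by move=> f g h; apply: iso_ext. Qed.
Let aut1l : left_id (iso_id t : aut t) (fun f g => iso_comp f g).
Proof. by move=> f; apply: iso_ext. Qed.
Let aut1r : right_id (iso_id t : aut t) (fun f g => iso_comp f g).
Proof. by move=> f; apply: iso_ext. Qed.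
Let autVl :
  left_inverse (iso_id t : aut t) (@iso_sym t t) (fun f g => iso_comp f g).
Proof. by move=> f; apply: iso_ext => v /=; rewrite iso_invK. Qed.
Let autVr :
  right_inverse (iso_id t : aut t) (@iso_sym t t) (fun f g => iso_comp f g).
Proof. by move=> f; apply: iso_ext => v /=; rewrite iso_funK. Qed.

(* In a product g * h, g acts first. *)
HB.instance Definition _ :=
  isGroup.Build (aut t) autA aut1l aut1r autVl autVr.

Lemma autM g h v : (g * h) v = h (g v). Proof. by []. Qed.
Lemma aut1 v : (1 : aut t) v = v. Proof. by []. Qed.
Lemma autK g v : g^-1 (g v) = v. Proof. exact: iso_funK. Qed.
Lemma autKV g v : g (g^-1 v) = v. Proof. exact: iso_invK. Qed.

End AutGroup.

Definition transport (s t : rtree) (f : rtree_iso s t) (g : aut s) : aut t :=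
  iso_comp (iso_sym f) (iso_comp g f).

Section Actions.
Variables (gT : groupType) (t : rtree) (act : gT -> aut t).

Definition faithful_on := forall g : gT, (forall v, act g v = v) -> g = 1.

Definition level_transitive :=
  forall (n : nat) (u v : t), level n u -> level n v ->
    exists g : gT, act g u = v.

End Actions.

Section Words.
Variable X : finType.

Definition words : rtree :=
  @RTree (seq X) [::] (fun w w' => exists x, w' = rcons w x).

Local Notation autX := (aut words).
Implicit Types (g h : autX) (v w : seq X).

Lemma aut_nil g : g [::] = [::]. Proof. exact: (iso_root g). Qed.

Lemma aut_rcons g w x : exists y, g (rcons w x) = rcons (g w) y.
Proof. by apply: (@iso_child _ _ g); exists x. Qed.

Lemma aut_size g w : size (g w) = size w.
Proof.
elim/last_ind: w => [|w x IHw]; first by rewrite aut_nil.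
by have [y ->] := aut_rcons g w x; rewrite !size_rcons IHw.
Qed.

Definition restr_fun g v w : seq X := drop (size v) (g (v ++ w)).

Lemma restr_funE g v w : g (v ++ w) = g v ++ restr_fun g v w.
Proof.
suff [w' E] : exists w', g (v ++ w) = g v ++ w'.
  by rewrite /restr_fun E -(aut_size g v) drop_size_cat.
elim/last_ind: w => [|w x [w' IHw]]; first by exists [::]; rewrite !cats0.
have [y] := aut_rcons g (v ++ w) x.
by rewrite rcons_cat => ->; exists (rcons w' y); rewrite IHw rcons_cat.
Qed.

Lemma restr_funK g v :
  cancel (restr_fun g v) (restr_fun g^-1 (g v)).
Proof.
by move=> w; rewrite {1}/restr_fun -restr_funE autK aut_size drop_size_cat.
Qed.

Lemma restr_fun_child g v w w' : child (w : words) (w' : words) ->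
  child (restr_fun g v w : words) (restr_fun g v w' : words).
Proof.
case=> x ->; rewrite /restr_fun -rcons_cat.
have [y ->] := aut_rcons g (v ++ w) x; exists y.
by rewrite drop_rcons // aut_size size_cat leq_addr.
Qed.

(* The restriction g|_v. *)
Definition restr g v : autX.
Proof.
apply: (@RTreeIso words words (restr_fun g v) (restr_fun g^-1 (g v))).
- exact: restr_funK.
- by have := @restr_funK g^-1 (g v); rewrite autK invgK.
- by rewrite /restr_fun /= cats0 -(aut_size g) drop_size.
- exact: restr_fun_child.
- exact: restr_fun_child.
Defined.

Lemma restrE g v w : g (v ++ w) = g v ++ restr g v w.
Proof. exact: restr_funE. Qed.

Definition wr_fun (s : X -> autX) (pi : {perm X}) (w : seq X) : seq X :=
  if w is x :: w' then pi x :: s x w' else [::].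

Lemma wr_funK s pi :
  cancel (wr_fun s pi) (wr_fun (fun x => (s (pi^-1 x))^-1) pi^-1).
Proof. by case=> [|x w] //=; rewrite permK; congr cons; apply: (iso_funK (s x)). Qed.

Lemma wr_fun_child s pi w w' : child (w : words) (w' : words) ->
  child (wr_fun s pi w : words) (wr_fun s pi w' : words).
Proof.
case=> y ->; case: w => [|x w] /=; first by exists (pi y); rewrite aut_nil.
by have [z ->] := aut_rcons (s x) w y; exists z.
Qed.

(* The automorphism written (s 0, ..., s (p-1)) pi. *)
Definition wr (s : X -> autX) (pi : {perm X}) : autX.
Proof.
apply: (@RTreeIso words words (wr_fun s pi)
          (wr_fun (fun x => (s (pi^-1 x))^-1) pi^-1)).
- exact: wr_funK.
- by case=> [|x w] //=; rewrite permKV; congr cons; apply: (iso_invK (s (pi^-1 x))).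
- by [].
- exact: wr_fun_child.
- exact: wr_fun_child.
Defined.

Lemma wr_nil s pi : wr s pi [::] = [::]. Proof. by []. Qed.
Lemma wr_cons s pi x w : wr s pi (x :: w) = pi x :: s x w. Proof. by []. Qed.

Lemma restr_wr s pi x : restr (wr s pi) [:: x] = s x.
Proof. by apply: iso_ext => w; rewrite /= /restr_fun /= drop0. Qed.

End Words.

Section Sushchansky.
Import GRing.Theory.
Local Open Scope ring_scope.
Local Open Scope group_scope.

Variables (p : nat) (lam : 'Z_(p ^ 2) -> 'F_p * 'F_p).

Local Notation X := 'F_p.
Local Notation autX := (aut (words X)).

(* Only meaningful when 2 < p, so that 0, 1, 2 are distinct letters. *)
Definition triple (a b c : autX) (x : X) : autX :=
  if x == 0%R then a else if x == 1%R then b else if x == 2%:R%R then c else 1.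

Definition sigma_perm : {perm X} := perm (addIr (1%R : X)).

Definition sigma : autX := wr (fun=> 1) sigma_perm.

Fixpoint chain_fun (a : 'Z_(p ^ 2) -> autX) (i : 'Z_(p ^ 2)) (w : seq X) :
    seq X :=
  if w is x :: w' then
    x :: (if x == 0%R then chain_fun a (i + 1)%R w'
          else if x == 1%R then a i w' else w')
  else [::].

Lemma chain_funK a i :
  cancel (chain_fun a i) (chain_fun (fun j => (a j)^-1) i).
Proof.
move=> w; elim: w i => [|x w IHw] i //=; congr (_ :: _).
by case: (x == 0%R) => //; case: (x == 1%R) => //; apply: (iso_funK (a i)).
Qed.

Lemma chain_fun_child a i w w' : child (w : words X) (w' : words X) ->
  child (chain_fun a i w : words X) (chain_fun a i w' : words X).
Proof.
case=> y ->; elim: w i => [|x w IHw] i /=.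
  by exists y; rewrite aut_nil; case: ifP => // _; case: ifP.
case: ifP => _; first by have [z ->] := IHw (i + 1)%R; exists z.
case: ifP => _; last by exists y.
by have [z ->] := aut_rcons (a i) w y; exists z.
Qed.

(* The solution c of the recursion c_i = (c_{i+1}, a_i, 1, ..., 1);
   see chainE. *)
Definition chain (a : 'Z_(p ^ 2) -> autX) (i : 'Z_(p ^ 2)) : autX.
Proof.
apply: (@RTreeIso (words X) (words X) (chain_fun a i)
          (chain_fun (fun j => (a j)^-1) i)).
- exact: chain_funK.
- move=> w; have := @chain_funK (fun j => (a j)^-1) i w.
  by congr (chain_fun _ _ _ = _); apply: funext => j; rewrite invgK.
- by [].
- exact: chain_fun_child.
- exact: chain_fun_child.
Defined.

Lemma chainE a i : chain a i = wr (triple (chain a (i + 1)%R) (a i) 1) 1.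
Proof.
apply: iso_ext => -[|x w] //=; rewrite perm1 /triple; congr (_ :: _).
by do 3!case: ifP => //.
Qed.

Lemma chain_unique a (c : 'Z_(p ^ 2) -> autX) :
  (forall i, c i = wr (triple (c (i + 1)%R) (a i) 1) 1) -> c =1 chain a.
Proof.
move=> cE i; apply: iso_ext => w; elim: w i => [|x w IHw] i.
  by rewrite !aut_nil.
rewrite cE chainE !wr_cons /triple; congr (_ :: _).
by case: ifP => // _; apply: IHw.
Qed.

(* The index set {1, ..., p^2} modulo p^2 is 'Z_(p ^ 2). *)
Definition u_ (i : 'Z_(p ^ 2)) : X := if (lam i).2 == 0%R then 0%R else 1%R.

Definition v_ (i : 'Z_(p ^ 2)) : X :=
  if (lam i).2 == 0%R then 1%R else (- ((lam i).1 / (lam i).2))%R.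

(* In sigma ^+ a with a : 'F_p, a stands for its representative in [0, p[;
   sigma has order p. *)
Definition q_ : 'Z_(p ^ 2) -> autX := chain (fun i => sigma ^+ u_ i).

Definition r_ : 'Z_(p ^ 2) -> autX := chain (fun i => sigma ^+ v_ i).

Lemma q_E i : q_ i = wr (triple (q_ (i + 1)%R) (sigma ^+ u_ i) 1) 1.
Proof. exact: chainE. Qed.

Lemma r_E i : r_ i = wr (triple (r_ (i + 1)%R) (sigma ^+ v_ i) 1) 1.
Proof. exact: chainE. Qed.

Definition susA : autX := wr (fun x : X => sigma ^+ x) sigma_perm.

Definition susB_restr (x y : X) : autX :=
  if (x, y) == (0, 0)%R then q_ 1%R
  else if (x, y) == (1, 0)%R then r_ 1%R
  else if (x, y) == (2%:R, 1)%R then sigma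
  else 1.

Definition susB : autX := wr (fun x => wr (susB_restr x) 1) 1.

Lemma susB_fix2 x y : susB [:: x; y] = [:: x; y].
Proof. by rewrite !wr_cons !perm1 aut_nil. Qed.

Lemma restr_susB x y : restr susB [:: x; y] = susB_restr x y.
Proof. by apply: iso_ext => w; rewrite /= /restr_fun /= drop0. Qed.

Definition sus_gen (g : autX) : Prop := g = susA \/ g = susB.

Definition sus : groupType := gen_group sus_gen.

Definition sus_val (g : sus) : autX := gen_val g.

Definition genA : sus := @gen_of _ sus_gen susA (or_introl erefl).
Definition genB : sus := @gen_of _ sus_gen susB (or_intror erefl).

Definition orb00 (w : seq X) : Prop :=
  exists g : sus, sus_val g [:: 0; 0]%R = w.

Definition inV (w : seq X) : Prop :=
  w = [::] \/ exists x y w', w = [:: x, y & w'] /\ orb00 [:: x; y].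

Definition T_vertex : Type := {w : seq X | `[< inV w >]}.

Lemma inV_nil : `[< inV [::] >]. Proof. by apply/asboolP; left. Qed.

Definition T : rtree :=
  @RTree T_vertex (exist (fun w => `[< inV w >]) [::] inV_nil) (fun u v =>
    if val u is [::] then orb00 (val v)
    else exists x, val v = rcons (val u) x).

Lemma orb00_stable (g : sus) w : orb00 w -> orb00 (sus_val g w).
Proof. by case=> h <-; exists (h * g). Qed.

Lemma inV_stable (g : sus) w : inV w -> inV (sus_val g w).
Proof.
case=> [->|[x [y [w' [-> xyO]]]]]; first by left; rewrite aut_nil.
right; have := orb00_stable g xyO; rewrite (restrE (sus_val g) [:: x; y] w').
have := aut_size (sus_val g) [:: x; y].
by case: (sus_val g _) => [|x1 [|y1 []]] // _ O1; exists x1, y1; eexists.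
Qed.

Definition T_act_fun (g : sus) (v : T) : T :=
  exist (fun w => `[< inV w >]) (sus_val g (val v))
    (asboolT (inV_stable g (asboolW (valP v)))).

Lemma T_act_fun_child (g : sus) (u v : T) :
  child u v -> child (T_act_fun g u) (T_act_fun g v).
Proof.
case: u v => [[|x u] Vu] [v Vv] /=; first by rewrite aut_nil; apply: orb00_stable.
case=> y ->; have := aut_size (sus_val g) (x :: u).
have [z ->] := aut_rcons (sus_val g) (x :: u) y.
by case: (sus_val g (x :: u)) => // x1 u1 _; exists z.
Qed.

Lemma T_act_funK (g : sus) : cancel (T_act_fun g) (T_act_fun g^-1).
Proof. by move=> v; apply: val_inj; apply: (iso_funK (sus_val g)). Qed.

Definition T_act (g : sus) : aut T.
Proof.
apply: (@RTreeIso T T (T_act_fun g) (T_act_fun g^-1)).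
- exact: T_act_funK.
- by have := @T_act_funK g^-1; rewrite invgK.
- by apply: val_inj; apply: aut_nil.
- exact: T_act_fun_child.
- exact: T_act_fun_child.
Defined.

Lemma T_actE (g : sus) (v : T) : val (T_act g v) = sus_val g (val v).
Proof. by []. Qed.

Lemma T_actM : {morph T_act : g h / g * h}.
Proof. by move=> g h; apply: iso_ext => v; apply: val_inj. Qed.

Definition phi_fun (v : T) : words X :=
  if val v is [:: x, y & w] then x :: w else [::].

Hypotheses (p_pr : prime p) (p_gt2 : (2 < p)%N).

Definition orb_letter (x : X) : X := (x * (x - 1) / 2%:R)%R.

Lemma two_neq0 : (2%:R != 0 :> X)%R.
Proof.
rewrite -(dvdn_pcharf (pchar_Fp p_pr)).
by apply: contraL p_gt2 => /dvdn_leq; rewrite -leqNgt; apply.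
Qed.

Lemma sigma_exp n (x : X) w : (sigma ^+ n) (x :: w) = (x + n%:R)%R :: w.
Proof.
elim: n x => [|n IHn] x; first by rewrite expg0 /= addr0.
by rewrite expgS autM wr_cons permE IHn /= -addrA -natr1 [(1 + _)%R]addrC.
Qed.

Lemma susA_letters x y : susA [:: x; y] = [:: x + 1; y + x]%R.
Proof. by rewrite wr_cons permE sigma_exp natr_Zp. Qed.

Lemma orb_letterS x : orb_letter (x + 1) = (orb_letter x + x)%R.
Proof.
rewrite /orb_letter addrK; apply: (mulIf two_neq0).
by rewrite [RHS]mulrDl !divfK ?two_neq0 // mulr_natr mulr2n
  mulrBr mulr1 addrA subrK mulrDl mul1r.
Qed.

Lemma sus_letters (g : sus) x y : exists x' y',
  sus_val g [:: x; y] = [:: x'; y'] /\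
  (y' - orb_letter x' = y - orb_letter x)%R.
Proof.
pose H : {pred autX} := fun h => `[< forall x y, exists x' y',
  h [:: x; y] = [:: x'; y'] /\ (y' - orb_letter x' = y - orb_letter x)%R >].
suff /asboolP : sus_val g \in H by apply.
have /generatedP : sus_val g \in generated sus_gen by apply: gen_valP.
apply=> [|h [->|->]]; last 2 first.
- apply/asboolP => a b; exists (a + 1)%R, (b + a)%R; rewrite susA_letters.
  by rewrite orb_letterS opprD [(- _ - a)%R]addrC addrA addrK.
- by apply/asboolP => a b; exists a, b; rewrite susB_fix2.
split=> [|h k /asboolP Hh /asboolP Hk].
  by apply/asboolP => a b; exists a, b.
apply/asboolP => a b; have [a1 [b1 [E1 <-]]] := Hh a b.
rewrite autM E1; have := aut_size k^-1 [:: a1; b1].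
case Ek: (k^-1 _) => [|a2 [|b2 []]] // _; exists a2, b2; split=> //.
have [a3 [b3 [E3 <-]]] := Hk a2 b2.
by move: E3; rewrite -Ek autKV => -[-> ->].
Qed.

Lemma orb00P x y : orb00 [:: x; y] <-> y = orb_letter x.
Proof.
have ol0 : orb_letter 0 = 0%R by rewrite /orb_letter !mul0r.
split=> [[g]|->].
  have [a [b [-> +]]] := sus_letters g 0%R 0%R; rewrite ol0 subr0.
  by move=> /eqP; rewrite subr_eq0 => /eqP -> [<- <-].
rewrite -[x]natr_Zp; elim: (x : nat) => [|n IHn].
  by exists 1; rewrite ol0.
have [g E] := IHn; exists (g * genA).
have -> : sus_val (g * genA) [:: 0; 0]%R = susA (sus_val g [:: 0; 0]%R) by [].
by rewrite E -natr1 orb_letterS -susA_letters.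
Qed.

Definition phi_inv_fun (w : words X) : seq X :=
  if w is x :: w' then [:: x, orb_letter x & w'] else [::].

Lemma phi_inv_inV w : `[< inV (phi_inv_fun w) >].
Proof.
apply/asboolP; case: w => [|x w]; first by left.
by right; exists x, (orb_letter x), w; split=> //; apply/orb00P.
Qed.

(* The identification xyw |-> xw of T with the tree of words. *)
Definition phi : rtree_iso T (words X).
Proof.
apply: (@RTreeIso T (words X) phi_fun
  (fun w => exist (fun w => `[< inV w >]) (phi_inv_fun w) (phi_inv_inV w))).
- case=> v Vv; apply: val_inj; rewrite /phi_fun /=.
  by case/asboolP: (Vv) => [->|[x [y [w [-> /orb00P ->]]]]].
- by case.
- by [].
- case=> u Vu [v Vv] /=; rewrite /phi_fun /=.
  case/asboolP: (Vu) => [->|[x [y [w [-> _]]]]] /=.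
    case=> g <-; have [a [b [-> _]]] := sus_letters g 0%R 0%R.
    by exists a.
  by case=> z ->; exists z.
- move=> u v [x ->] /=; case: u => [|y u] /=; first exact/orb00P.
  by exists x.
Defined.

Lemma phiE (v : T) (x y : X) (w : seq X) :
  val v = [:: x, y & w] -> phi v = x :: w.
Proof. by move=> E; rewrite /= /phi_fun E. Qed.

End Sushchansky.

Arguments T_act {p} lam g.

(* Main.v *)
(* B_lambda acts nontrivially only below the words of Orb(00).  Hence an element
   of G_lambda acts outside T as a power of A, which changes two letters only and
   whose exponent modulo p is visible on the first level of T: the action on T is
   faithful.

   For level-transitivity put H_i = <sigma, q_i, r_i>.  The elements of H_i fixing
   the letter 0 act below it as a group containing q_{i+1}, r_{i+1} and, since
   u_i = 1 or v_i = 1, also sigma; that is, H_{i+1}.  Likewise G_lambda acts below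
   the letter 0 of T through a group containing H_1.  As sigma permutes the letters
   transitively, induction on the length of words concludes. *)

Require Import Defs.
From mathcomp Require Import all_boot all_order all_algebra all_fingroup.
From mathcomp Require Import boolp.

Set Implicit Arguments.
Unset Strict Implicit.
Unset Printing Implicit Defensive.

Import GRing.Theory.
Local Open Scope ring_scope.
Local Open Scope group_scope.

Lemma group_closedX (gT : groupType) (H : {pred gT}) g n :
  group_closed H -> g \in H -> g ^+ n \in H.
Proof.
move=> gH Hg; elim: n => [|n IHn]; first by rewrite expg0 gH.1.
by rewrite expgS group_closedM.
Qed.

Lemma transportM (s t : rtree) (f : rtree_iso s t) :
  {morph transport f : g h / g * h}.
Proof. by move=> g h; apply: iso_ext => v /=; rewrite iso_funK. Qed.

Lemma transport_fun (s t : rtree) (f : rtree_iso s t) (g : Defs.aut s) v :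
  transport f g (f v) = f (g v).
Proof. by rewrite /= iso_funK. Qed.

Lemma level_iso (s t : rtree) (f : rtree_iso s t) n v :
  level n v -> level n (f v).
Proof.
elim: n v => [|n IHn] v /=; first by move->; apply: iso_root.
by case=> u lu uv; exists (f u); [apply: IHn | apply: iso_child].
Qed.

Lemma level_words (X : finType) n (w : words X) : level n w -> size w = n.
Proof.
elim: n w => [|n IHn] w /=; first by move->.
by case=> u /IHn <- [x ->]; rewrite size_rcons.
Qed.

Definition transitive_on_words (X : finType) (H : {pred Defs.aut (words X)}) n :=
  forall w w' : seq X, size w = n -> size w' = n -> exists2 h, h \in H & h w = w'.

(** * Lifting automorphisms to the branch below the letter 0 *)

Section Action.
Variable p : nat.
Hypotheses (p_pr : prime p) (p_gt2 : (2 < p)%N).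

Local Notation X := 'F_p.
Local Notation autX := (Defs.aut (words X)).
Local Notation sigma := (sigma p).

Lemma one0 : (1 == 0 :> X)%R = false.
Proof. exact/negbTE/oner_neq0. Qed.

Lemma two0 : (2%:R == 0 :> X)%R = false.
Proof. exact/negbTE/two_neq0. Qed.

Lemma two1 : (2%:R == 1 :> X)%R = false.
Proof. by rewrite -subr_eq0 mulr2n addrK one0. Qed.

Lemma sigma_cons (x : X) w : sigma (x :: w) = (x + 1)%R :: w.
Proof. by rewrite wr_cons permE. Qed.

Lemma sigma_expF (a x : X) w : (sigma ^+ a) (x :: w) = (x + a)%R :: w.
Proof. by rewrite sigma_exp natr_Zp. Qed.

Lemma sigma_expF0 (a : X) w : (sigma ^+ a) (0%R :: w) = a :: w.
Proof. by rewrite sigma_expF add0r. Qed.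

Definition lift0 (H : {pred autX}) (k : autX) : Prop :=
  exists2 h, h \in H & forall w, h (0%R :: w) = 0%R :: k w.

(** Lifts fix the letter 0, so their restrictions there multiply as they do; the liftable [k] thus
    form a group, and generators suffice. *)
Lemma lift0_generated (H : {pred autX}) (S : autX -> Prop) : group_closed H ->
  (forall k, S k -> lift0 H k) -> forall k, k \in Defs.generated S -> lift0 H k.
Proof.
move=> gH HS k /Defs.generatedP Gk.
suff /asboolP : k \in ((fun k => `[< lift0 H k >]) : {pred autX}) by [].
apply: Gk => [|s Ss]; last exact/asboolP/HS.
split=> [|g h /asboolP [g1 Hg gE] /asboolP [h1 Hh hE]]; apply/asboolP.
  by exists 1; rewrite ?gH.1.
exists (g1 * h1^-1) => [|w]; first exact: gH.2.
by rewrite autM gE -{1}[g w](autKV h) -hE autK.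
Qed.

(** Powers of [sigma] change only the first letter, so conjugating by one carries the branch at [a]
    to the branch at 0 without altering the restriction. *)
Lemma lift0_conj (H : {pred autX}) (a : X) (b k : autX) :
  group_closed H -> sigma \in H -> b \in H ->
  (forall w, b (a :: w) = a :: k w) -> lift0 H k.
Proof.
move=> gH Hs Hb bE; have Ha := group_closedX a gH Hs.
exists (sigma ^+ a * b * (sigma ^+ a)^-1) => [|w].
  by apply: group_closedM => //; [apply: group_closedM|apply: group_closedV].
by rewrite !autM sigma_expF0 bE -sigma_expF0 autK.
Qed.

Lemma transitive_on_wordsS (H K : {pred autX}) n :
  group_closed H -> sigma \in H -> (forall k, k \in K -> lift0 H k) ->
  transitive_on_words K n -> transitive_on_words H n.+1.
Proof.
move=> gH Hs HK Kn [|x w] [|y w'] //= [sw] [sw'].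
have [k Kk <-] := Kn _ _ sw sw'; have [h Hh hE] := HK _ Kk.
(* Bring the first letter [x] to 0, correct the tail there by the lift of [k], then send 0 to
   [y]. *)
exists ((sigma ^+ x)^-1 * h * sigma ^+ y).
  have HX a := group_closedX a gH Hs.
  by apply: group_closedM => //; apply: group_closedM => //;
    apply: group_closedV.
by rewrite !autM -[x :: w]sigma_expF0 autK hE sigma_expF0.
Qed.

(** * Transitivity of the groups generated by [sigma], [q_ i], [r_ i] *)

Variable lam : 'Z_(p ^ 2) -> X * X.

Local Notation q_ := (q_ lam).
Local Notation r_ := (r_ lam).

Lemma sigma_exp1 : sigma ^+ (1%R : X) = sigma.
Proof. exact: expg1. Qed.

Lemma u_v_1 i : u_ lam i = 1%R \/ v_ lam i = 1%R.
Proof. by rewrite /u_ /v_; case: ifP => _; [right | left]. Qed.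

Definition chain_gen i (g : autX) : Prop := [\/ g = sigma, g = q_ i | g = r_ i].

Lemma chain_gen_lift0 i k :
  chain_gen (i + 1)%R k -> lift0 (Defs.generated (chain_gen i)) k.
Proof.
have gH := Defs.generated_group (chain_gen i).
have Hs : sigma \in Defs.generated (chain_gen i).
  by apply: Defs.mem_generated; constructor 1.
have Hq : q_ i \in Defs.generated (chain_gen i).
  by apply: Defs.mem_generated; constructor 2.
have Hr : r_ i \in Defs.generated (chain_gen i).
  by apply: Defs.mem_generated; constructor 3.
case=> ->.
(* [sigma] is found below the letter 1 of whichever of [q_ i], [r_ i] has exponent 1. *)
-   case: (u_v_1 i) => E; [apply: (lift0_conj (a := 1%R) gH Hs Hq) |
                         apply: (lift0_conj (a := 1%R) gH Hs Hr)] => w.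
  + by rewrite q_E wr_cons perm1 /triple one0 eqxx E sigma_exp1.
  + by rewrite r_E wr_cons perm1 /triple one0 eqxx E sigma_exp1.
- by exists (q_ i) => // w; rewrite {1}q_E wr_cons perm1.
- by exists (r_ i) => // w; rewrite {1}r_E wr_cons perm1.
Qed.

Lemma chain_transitive n i : transitive_on_words (Defs.generated (chain_gen i)) n.
Proof.
(* The index stays general because descending one letter replaces [i] by [i + 1]. *)
elim: n i => [|n IHn] i.
  move=> [|//] [|//] _ _; exists 1 => //; exact: (Defs.generated_group _).1.
apply: transitive_on_wordsS (IHn (i + 1)%R); first exact: Defs.generated_group.
  by apply: Defs.mem_generated; constructor 1.
apply: lift0_generated; first exact: Defs.generated_group.
exact: chain_gen_lift0.
Qed.

(** * The orbit of 00 and faithfulness *)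

Local Notation o := (@orb_letter p).

Lemma orb_letter0 : o 0%R = 0%R.
Proof. by rewrite /orb_letter !mul0r. Qed.

Lemma orb_letter1 : o 1%R = 0%R.
Proof. by rewrite /orb_letter subrr mulr0 mul0r. Qed.

Lemma orb_letter2 : o 2%:R%R = 1%R.
Proof.
by rewrite /orb_letter (_ : 2%:R - 1 = 1)%R ?mulr1 ?divff ?two_neq0 // mulr2n addrK.
Qed.

Lemma susA_cons x y w : susA p [:: x, y & w] = [:: x + 1, y + x & w]%R.
Proof. by rewrite wr_cons permE sigma_expF. Qed.

Lemma susB_cons x y w : susB lam [:: x, y & w] = [:: x, y & susB_restr lam x y w].
Proof. by rewrite !wr_cons !perm1. Qed.

(** The orbit words starting with 0, 1, 2 are 00, 10, 21, exactly the places where [susB_restr] is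
    defined by a nontrivial case. *)
Lemma susB_restr_orb x :
  susB_restr lam x (o x) = triple (q_ 1%R) (r_ 1%R) sigma x.
Proof.
rewrite /susB_restr /triple !xpair_eqE.
case: eqP => [->|_]; first by rewrite orb_letter0 eqxx.
rewrite andFb; case: eqP => [->|_]; first by rewrite orb_letter1 eqxx.
by rewrite andFb; case: eqP => [->|_] //; rewrite orb_letter2 eqxx.
Qed.

Lemma susB_restr_notorb x y : y != o x -> susB_restr lam x y = 1.
Proof.
rewrite /susB_restr !xpair_eqE.
case: (x =P 0%R) => [->|_]; first
  by rewrite orb_letter0 (eq_sym _ 1%R) one0 (eq_sym _ 2%:R%R) two0 => /negbTE ->.
rewrite andFb; case: (x =P 1%R) => [->|_]; first
  by rewrite orb_letter1 (eq_sym 1%R 2%:R%R) two1 => /negbTE ->.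
by rewrite andFb; case: (x =P 2%:R%R) => [->|_] //;
  rewrite orb_letter2 => /negbTE ->.
Qed.

(** On the first two letters this is the action of the [n]-th power of [susA]; the tail is left free
    only over Orb(00). *)
Definition shifts_by (g : autX) (n : X) : Prop := forall x y w, exists w',
  g [:: x, y & w] = [:: x + n, y + (o (x + n) - o x) & w']%R /\
  (y != o x -> w' = w).

Lemma sus_shifts_by (g : sus lam) : exists n, shifts_by (sus_val g) n.
Proof.
suff /asboolP : sus_val g \in
  ((fun h => `[< exists n, shifts_by h n >]) : {pred autX}) by [].
have /Defs.generatedP : sus_val g \in Defs.generated (sus_gen lam).
  exact: gen_valP.
apply=> [|h [->|->]]; last 2 first.
- apply/asboolP; exists 1%R => x y w; exists w; split=> //.
  by rewrite susA_cons orb_letterS // [(o x + x)%R]addrC addrK.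
- apply/asboolP; exists 0%R => x y w; exists (susB_restr lam x y w).
  by rewrite susB_cons addr0 subrr addr0; split=> // /susB_restr_notorb ->.
split=> [|h k /asboolP [n hn] /asboolP [m km]]; apply/asboolP.
  by exists 0%R => x y w; exists w; rewrite addr0 subrr addr0.
exists (n - m)%R => x y w; have [w1 [E1 N1]] := hn x y w.
rewrite autM E1; set x1 := (x + n)%R; set y1 := (y + _)%R.
have := aut_size k^-1 [:: x1, y1 & w1].
case Ek: (k^-1 _) => [|x2 [|y2 w2]] // _; exists w2.
(* The image under [k^-1] is determined by applying [k] to it and comparing with the word before. *)
have [w3 [+ N3]] := km x2 y2 w2; rewrite -Ek autKV => /eqP.
rewrite !eqseq_cons => /and3P[/eqP Ex /eqP Ey /eqP Ew].
have Ex2 : x2 = (x + (n - m))%R by rewrite addrA -/x1 Ex addrK.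
have Ey2 : (y2 - o x2 = y - o x)%R.
  apply: (addIr (o (x2 + m)%R)); rewrite -addrA [(- _ + _)%R]addrC -Ey -Ex.
  by rewrite /y1 addrA addrAC.
split; first by rewrite Ek -Ex2 -(subrK (o x2) y2) Ey2 [in RHS]addrA addrAC.
(* The offset [y - o x] is invariant, so a word off the orbit stays off it and both tails are
   unchanged. *)
by move=> yo; rewrite -(N1 yo) Ew N3 // -(subr_eq0 y2) Ey2 subr_eq0.
Qed.

Lemma T_act_faithful : faithful_on (T_act lam).
Proof.
move=> g gT; apply: val_inj; apply: iso_ext => w; rewrite -[val g]/(sus_val g).
have fix_orb x w' : sus_val g [:: x, o x & w'] = [:: x, o x & w'].
  by have := T_actE g (iso_inv (phi lam p_pr p_gt2) (x :: w')); rewrite gT.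
have [n gn] := sus_shifts_by g.
have n0 : n = 0%R.
  by have [w' [+ _]] := gn 0%R (o 0) [::]; rewrite fix_orb add0r => -[].
have fix2 x y w' : sus_val g [:: x, y & w'] = [:: x, y & w'].
  have [->|yo] := eqVneq y (o x); first exact: fix_orb.
  by have [w1 [-> ->]] := gn x y w'; rewrite // n0 addr0 subrr addr0.
case: w => [|x [|y w]]; [exact: aut_nil | | exact: fix2].
(* A one-letter word is not a vertex of [T]; its image is read off as a prefix of the image of a
   two-letter word. *)
have := fix2 x 0%R [::]; rewrite -(cat1s x) restrE.
have := aut_size (sus_val g) [:: x].
by case: (sus_val g _) => [|z []] //= _ [-> _].
Qed.

(** * The generators on [T] and level-transitivity *)

Local Notation phi := (phi lam p_pr p_gt2).

Lemma transport_genA : transport phi (T_act lam (genA lam)) = sigma.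
Proof.
apply: iso_ext => -[|x w]; first by rewrite !aut_nil.
by rewrite sigma_cons; apply: phiE; apply: susA_cons.
Qed.

Lemma transport_genB : transport phi (T_act lam (genB lam)) =
  wr (triple (q_ 1%R) (r_ 1%R) sigma) 1.
Proof.
apply: iso_ext => -[|x w]; first by rewrite !aut_nil.
by rewrite wr_cons perm1 -susB_restr_orb; apply: phiE; apply: susB_cons.
Qed.

Definition T_image : {pred autX} :=
  fun k => `[< exists g, transport phi (T_act lam g) = k >].

Lemma T_image_group : group_closed T_image.
Proof.
split=> [|_ _ /asboolP [g <-] /asboolP [h <-]]; apply/asboolP.
  exists 1; apply: iso_ext => v; rewrite -[v](iso_invK phi) transport_fun aut1.
  by congr iso_fun; apply: val_inj.
exists (g * h^-1); apply: (canRL (mulgK _)).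
by rewrite -transportM -T_actM mulgKV.
Qed.

Lemma T_image_lift0 k : chain_gen 1%R k -> lift0 T_image k.
Proof.
have Hs : sigma \in T_image.
  by apply/asboolP; exists (genA lam); apply: transport_genA.
have Hb : wr (triple (q_ 1%R) (r_ 1%R) sigma) 1 \in T_image.
  by apply/asboolP; exists (genB lam); apply: transport_genB.
case=> ->.
(* Here [sigma] occurs directly as the restriction at the letter 2, whatever the exponents are. *)
- apply: (lift0_conj (a := 2%:R%R) T_image_group Hs Hb) => w.
  by rewrite wr_cons perm1 /triple two0 two1 eqxx.
- apply: (lift0_conj (a := 0%R) T_image_group Hs Hb) => w.
  by rewrite wr_cons perm1 /triple eqxx.
- apply: (lift0_conj (a := 1%R) T_image_group Hs Hb) => w.
  by rewrite wr_cons perm1 /triple one0 eqxx.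
Qed.

(** A single descent suffices, since the group reached below 0 is already known to be transitive on
    words of every length. *)
Lemma T_image_transitive n : transitive_on_words T_image n.
Proof.
case: n => [|n].
  by move=> [|//] [|//] _ _; exists 1; rewrite ?T_image_group.1.
apply: (transitive_on_wordsS T_image_group _ _ (@chain_transitive n 1%R)).
  by apply/asboolP; exists (genA lam); apply: transport_genA.
exact: (lift0_generated T_image_group T_image_lift0).
Qed.

Lemma T_act_level_transitive : level_transitive (T_act lam).
Proof.
move=> n u v /(level_iso phi)/level_words su /(level_iso phi)/level_words sv.
have [_ /asboolP [g <-]] := T_image_transitive su sv.
rewrite transport_fun => E; exists g.
by rewrite -[LHS](iso_funK phi) E iso_funK.
Qed.

End Action.

Theorem proposition4 (p : nat) (p_pr : prime p) (p_gt2 : (2 < p)%N)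
    (lam : 'Z_(p ^ 2) -> 'F_p * 'F_p) (lam_bij : bijective lam) :
  [/\ faithful_on (T_act lam),
      level_transitive (T_act lam),
      transport (phi lam p_pr p_gt2) (T_act lam (genA lam)) = sigma p
    & transport (phi lam p_pr p_gt2) (T_act lam (genB lam)) =
        wr (triple (q_ lam 1%R) (r_ lam 1%R) (sigma p)) 1%g].
Proof.
split; first exact: T_act_faithful.
- exact: T_act_level_transitive.
- exact: transport_genA.
- exact: transport_genB.
Qed.
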